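(* Let $G$ and $H$ be connected graphs with $|V(H)|-1\ge \chi(G)\ge \chi(H)$. Then $\chi(G\,\square\,H)\le \eta(G\,\square\,H)-1$.
   Context: All graphs are finite, simple and undirected. $\chi$ denotes chromatic number. $\eta(G)$ is the maximum $k$ such that $K_k$ is a minor of $G$. The Cartesian product $G\,\square\,H$ has vertex set $V(G)\times V(H)$, with $(v,x)(w,y)$ an edge iff ($vw\in E(G)$ and $x=y$) or ($v=w$ and $xy\in E(H)$). *)

(* Defs.v *)
From HB Require Import structures.
From mathcomp Require Import all_boot.

Set Implicit Arguments.
Unset Strict Implicit.
Unset Printing Implicit Defensive.

Record sgraph := SGraph {
  vertex :> finType;
  adj : rel vertex;
  adj_sym : symmetric adj;
  adj_irrefl : irreflexive adj
}.

Section Connectedness.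
Variable G : sgraph.

(* [A] is nonempty and induces a connected subgraph of [G]. *)
Definition connected_set (A : {set G}) : bool :=
  (A != set0) &&
  [forall x in A, forall y in A,
     connect [rel u v | [&& u \in A, v \in A & adj u v]] x y].

(* In particular, a connected graph has at least one vertex. *)
Definition connected_graph : bool := connected_set [set: G].

End Connectedness.

Section ChromaticNumber.
Variable G : sgraph.

Definition colorable (k : nat) : bool :=
  [exists f : {ffun G -> 'I_k}, forall x, forall y, adj x y ==> (f x != f y)].

Lemma colorable_card : exists k, colorable k.
Proof.
exists #|G|; apply/existsP; exists [ffun x => enum_rank x].
apply/forallP=> x; apply/forallP=> y; apply/implyP=> xy; rewrite !ffunE.
apply: contraTneq xy => /enum_rank_inj ->; by rewrite adj_irrefl.
Qed.

Definition chromatic_number : nat := ex_minn colorable_card.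

End ChromaticNumber.

Section Complete.
Variable k : nat.

Definition complete_adj : rel 'I_k := fun i j => i != j.

Lemma complete_sym : symmetric complete_adj.
Proof. by move=> i j; rewrite /complete_adj eq_sym. Qed.

Lemma complete_irrefl : irreflexive complete_adj.
Proof. by move=> i; rewrite /complete_adj eqxx. Qed.

Definition complete_graph : sgraph := SGraph complete_sym complete_irrefl.

End Complete.

(* [H] is a minor of [G]: the branch set [B i] is the vertex set of the
   connected subgraph of [G] that is contracted to the vertex [i] of [H];
   vertices of [G] in no branch set are deleted, as are superfluous edges. *)
Definition minor (H G : sgraph) : bool :=
  [exists B : {ffun H -> {set G}},
    [&& [forall i, connected_set (B i)],
        [forall i, forall j, (i != j) ==> [disjoint B i & B j]]
      & [forall i, forall j, adj i j ==>
           [exists x in B i, exists y in B j, adj x y]]]].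

Section HadwigerNumber.
Variable G : sgraph.

Lemma minor_complete0 : exists k, minor (complete_graph k) G.
Proof.
exists 0; apply/existsP; exists [ffun => set0].
by apply/and3P; split; apply/forallP; case.
Qed.

Lemma minor_complete_leq k : minor (complete_graph k) G -> k <= #|G|.
Proof.
case/existsP=> B /and3P[/forallP connB /forallP disjB _].
have /fin_all_exists[f fB] i : exists x, x \in B i.
  by have /andP[/set0Pn] := connB i.
rewrite -[k]card_ord; apply: (@leq_card _ _ f) => i j fij.
apply/eqP; apply: contraT => ij.
have /forallP/(_ j)/implyP/(_ ij)/disjointFr/(_ (fB i)) := disjB i.
by rewrite fij fB.
Qed.

Definition hadwiger : nat := ex_maxn minor_complete0 minor_complete_leq.

End HadwigerNumber.

Section CartesianProduct.
Variables G H : sgraph.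

Definition cartesian_adj : rel (G * H) := fun p q =>
  adj p.1 q.1 && (p.2 == q.2) || (p.1 == q.1) && adj p.2 q.2.

Lemma cartesian_sym : symmetric cartesian_adj.
Proof.
move=> p q; rewrite /cartesian_adj (adj_sym p.1) (adj_sym p.2).
by rewrite (eq_sym p.1) (eq_sym p.2).
Qed.

Lemma cartesian_irrefl : irreflexive cartesian_adj.
Proof. by move=> p; rewrite /cartesian_adj !adj_irrefl andbF. Qed.

Definition cartesian_product : sgraph := SGraph cartesian_sym cartesian_irrefl.

End CartesianProduct.

(* Main.v *)
Require Import Defs.
From mathcomp Require Import all_boot.

Set Implicit Arguments.
Unset Strict Implicit.
Unset Printing Implicit Defensive.

(** Let k = chi(G); summing colorings modulo k shows chi(G [] H) <= k, so a K_(k+1) minor of G [] H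
    is needed.  If a connected set S of G has k outside neighbors, a star with centre S and k leaves
    times H has such a minor, because H has at least k + 1 vertices.  Otherwise G has maximum degree
    at most k - 1, and being non-(k-1)-colorable it is (k-1)-regular and vertex-critical.  A K_k minor
    of G is enough in that case, as H has an edge; it exists when G is complete, and also when k = 3,
    where G is an odd cycle.  Finally, if G is not complete and k > 3, the sets S formed by the two ends
    of an edge have few neighbors, which forces G to be K_(2,...,2), which is (k-1)-colorable.  This
    replaces the appeal to Brooks' theorem. *)

(** * Connected vertex sets *)

Section Connectivity.
Variable G : sgraph.
Implicit Types (A B : {set G}) (x y : G).

Definition adj_in A u v := [&& u \in A, v \in A & adj u v].
Arguments adj_in A u v /.

Lemma adj_in_sym A : symmetric (adj_in A).
Proof. by move=> x y /=; rewrite adj_sym andbCA. Qed.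

Lemma connect_closed (e : rel G) (P : pred G) x y :
  (forall u v, P u -> e u v -> P v) -> P x -> connect e x y -> P y.
Proof.
move=> stepP + /connectP[p + ->]; elim: p x => [|z p IHp] x //= Px /andP[xz zp].
exact: IHp (stepP _ _ Px xz) zp.
Qed.

Lemma connected_set_from A x0 :
  x0 \in A -> (forall x, x \in A -> connect (adj_in A) x0 x) -> connected_set A.
Proof.
move=> Ax0 conA; apply/andP; split; first by apply/set0Pn; exists x0.
apply/forall_inP=> x Ax; apply/forall_inP=> y Ay.
apply: connect_trans (conA y Ay).
by rewrite (sym_connect_sym (adj_in_sym A)) conA.
Qed.

Lemma connected_set_connect A x y :
  connected_set A -> x \in A -> y \in A -> connect (adj_in A) x y.
Proof. by case/andP=> _ /forall_inP conA Ax Ay; apply: (forall_inP (conA x Ax)). Qed.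

Lemma connected_set1 x : connected_set [set x].
Proof. by apply: (@connected_set_from _ x) => [|y]; rewrite inE // => /eqP->. Qed.

Lemma connect_adj_inS A B : A \subset B ->
  subrel (connect (adj_in A)) (connect (adj_in B)).
Proof.
move=> sAB; apply: connect_sub => x y /and3P[Ax Ay xy]; apply: connect1.
by rewrite /= !(subsetP sAB).
Qed.

Lemma connected_setU A B x y : connected_set A -> connected_set B ->
  x \in A -> y \in B -> adj x y -> connected_set (A :|: B).
Proof.
move=> conA conB Ax By xy.
have [sA sB] := (subsetUl A B, subsetUr A B).
apply: (@connected_set_from _ x); first by rewrite inE Ax.
move=> z /setUP[Az|Bz].
  by apply: (connect_adj_inS sA); apply: connected_set_connect.
apply: (@connect_trans _ _ y); last first.
  by apply: (connect_adj_inS sB); apply: connected_set_connect.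
by apply: connect1; rewrite /= !inE Ax By orbT xy.
Qed.

Lemma connected_component A x0 : x0 \in A ->
  connected_set [set x | connect (adj_in A) x0 x].
Proof.
move=> Ax0; set D := [set x | _].
have Dx0 : x0 \in D by rewrite inE connect0.
apply: (connected_set_from Dx0) => x; rewrite inE.
(* Membership in [D] is carried along the path, so that every step taken in [A] is also a step in
   [D]. *)
suff: forall u, connect (adj_in A) x0 u -> (u \in D) && connect (adj_in D) x0 u.
  by move=> conD /conD/andP[].
move=> u; apply: (@connect_closed _ (fun u => (u \in D) && connect (adj_in D) x0 u)); last by rewrite Dx0 connect0.
move=> {}u w /andP[Du conu] uw.
have Dw : w \in D.
  by move: Du; rewrite !inE => /connect_trans; apply; apply: connect1.
rewrite Dw /=; apply: (connect_trans conu); apply: connect1.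
by case/and3P: uw => _ _ uw; rewrite /= Du Dw.
Qed.

Lemma connected_graph_closed (P : pred G) x : connected_graph G ->
  (forall u v, P u -> adj u v -> P v) -> P x -> forall y, P y.
Proof.
move=> conG stepP Px y.
have:= connected_set_connect conG (in_setT x) (in_setT y).
apply: connect_closed Px => u v Pu /and3P[_ _]; exact: stepP.
Qed.

Lemma connected_graph_edge : connected_graph G -> 1 < #|G| -> exists x y : G, adj x y.
Proof.
move=> conG /card_gt1P[x [y [_ _ xy]]].
have [/existsP[u /existsP[v uv]]|/existsPn noedge] := boolP [exists u, exists v : G, adj u v].
  by exists u, v.
(* Without edges, the singleton of [x] is closed under adjacency and hence contains [y]. *)
case/eqP: xy; apply/esym/eqP; move: y; apply: (@connected_graph_closed (eq_op^~ x) x) => //=.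
by move=> u v _ uv; have /existsPn/(_ v) := noedge u; rewrite uv.
Qed.

End Connectivity.

(** * Clique models in graphs and in products *)

Lemma connected_imset (G P : sgraph) (f : G -> P) (A : {set G}) :
  (forall x y, adj x y -> adj (f x) (f y)) -> connected_set A -> connected_set (f @: A).
Proof.
move=> homf conA; have /andP[/set0Pn[x0 Ax0] _] := conA.
apply: (@connected_set_from _ _ (f x0)); first exact: imset_f.
move=> _ /imsetP[x Ax ->].
have:= connected_set_connect conA Ax0 Ax.
apply: (@connect_closed _ _ (fun z => connect _ (f x0) (f z))) => // u v conu uv.
apply: connect_trans conu _; apply: connect1; case/and3P: uv => Au Av uv.
by rewrite /adj_in !imset_f ?homf.
Qed.

(** The index type is arbitrary, so that [option I] can add one branch set to a family indexed by
    [I]. *)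
Definition clique_model (G : sgraph) (I : finType) (B : I -> {set G}) :=
  [/\ forall i, connected_set (B i),
      forall i j z, z \in B i -> z \in B j -> i = j
    & forall i j, i != j -> exists x y, [/\ x \in B i, y \in B j & adj x y]].

Lemma hadwiger_ge (G : sgraph) (I : finType) (B : I -> {set G}) :
  clique_model B -> #|I| <= hadwiger G.
Proof.
case=> conB disB adjB; rewrite /hadwiger; case: ex_maxnP => m _; apply.
apply/existsP; exists [ffun i : 'I_#|I| => B (enum_val i)]; apply/and3P; split.
- by apply/forallP=> i; rewrite ffunE.
- apply/forallP=> i; apply/forallP=> j; apply/implyP=> ij; rewrite !ffunE.
  apply/pred0P=> z /=; apply: contraNF ij => /andP[Biz Bjz].
  by apply/eqP/enum_val_inj/(disB _ _ z).
apply/forallP=> i; apply/forallP=> j; apply/implyP=> ij; rewrite !ffunE.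
have [|x [y [Bx By xy]]] := adjB (enum_val i) (enum_val j).
  by rewrite (inj_eq enum_val_inj).
by apply/exists_inP; exists x => //; apply/exists_inP; exists y.
Qed.

Lemma connected_row (G H : sgraph) (A : {set G}) (y : H) :
  connected_set A -> connected_set (setX A [set y] : {set cartesian_product G H}).
Proof.
move=> conA; have -> : setX A [set y] = [set (x, y) | x in A].
  apply/setP=> -[x z]; rewrite !inE /=; apply/andP/imsetP => [[Ax /eqP->]|].
    by exists x.
  by case=> t At [-> ->].
apply: (connected_imset (f := fun x => (x, y) : cartesian_product G H)) conA.
by move=> u v uv; rewrite /= /cartesian_adj /= uv eqxx.
Qed.

Lemma connected_col (G H : sgraph) (x : G) (B : {set H}) :
  connected_set B -> connected_set (setX [set x] B : {set cartesian_product G H}).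
Proof.
move=> conB; have -> : setX [set x] B = [set (x, y) | y in B].
  apply/setP=> -[z y]; rewrite !inE /=; apply/andP/imsetP => [[/eqP-> By]|].
    by exists y.
  by case=> t Bt [-> ->].
apply: (connected_imset (f := fun y => (x, y) : cartesian_product G H)) conB.
by move=> u v uv; rewrite /= /cartesian_adj /= uv eqxx orbT.
Qed.

Lemma leq_card_injection (S T : finType) :
  #|S| <= #|T| -> {f : S -> T | injective f}.
Proof.
move=> leST; exists (fun x => enum_val (widen_ord leST (enum_rank x))).
by move=> x y /enum_val_inj/(congr1 val)/= /val_inj/enum_rank_inj.
Qed.

Section ProductModels.
Variables G H : sgraph.
Hypotheses (conG : connected_graph G) (conH : connected_graph H).
Local Notation P := (cartesian_product G H).

(** For an edge [h h'] of [H], the model is placed in the copy of [G] at [h]. The whole copy at [h']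
    is one more branch set, which meets every vertex of the first copy through a copy of this
    edge. *)
Lemma hadwiger_prod_edge (I : finType) (B : I -> {set G}) :
  clique_model B -> 1 < #|H| -> #|I|.+1 <= hadwiger P.
Proof.
case=> conB disB adjB /(connected_graph_edge conH)[h [h' hh']].
have neh : h != h' by apply: contraTneq hh' => ->; rewrite adj_irrefl.
rewrite -card_option.
pose C (o : option I) : {set P} :=
  if o is Some i then setX (B i) [set h] else setX [set: G] [set h'].
apply: (@hadwiger_ge _ _ C); split.
- by case=> [i|]; apply: connected_row.
- case=> [i|] [j|] [x y] //; rewrite !inE /=.
  + by case/andP=> Bi _ /andP[Bj _]; rewrite (disB _ _ _ Bi Bj).
  + by case/andP=> _ /eqP-> /idPn[].
  + by move/eqP=> -> /andP[_]; rewrite eq_sym (negPf neh).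
case=> [i|] [j|] // ij.
- have [x [y [Bx By xy]]] := adjB i j ij.
  by exists (x, h), (y, h); rewrite !inE Bx By /= /cartesian_adj /= xy !eqxx.
- have /andP[/set0Pn[x Bx] _] := conB i.
  by exists (x, h), (x, h'); rewrite !inE Bx /= /cartesian_adj /= hh' !eqxx orbT.
- have /andP[/set0Pn[x Bx] _] := conB j; exists (x, h'), (x, h).
  by rewrite !inE Bx /= /cartesian_adj /= adj_sym hh' !eqxx orbT.
Qed.

Definition neighbors (S : {set G}) := [set x in ~: S | [exists y in S, adj y x]].

(* A star with centre [S] and [k] leaves: the branch set of a leaf is its copy of [H] together with
   a private copy of [S], which meets the copies of [H] of all the other leaves. *)
Lemma hadwiger_prod_star (S : {set G}) k : connected_set S ->
  k <= #|neighbors S| -> k < #|H| -> k.+1 <= hadwiger P.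
Proof.
move=> conS kN kH.
have kN' : #|'I_k| <= #|{: {x | x \in neighbors S}}| by rewrite card_ord card_sig.
have [leaf0 leaf0_inj] := leq_card_injection kN'.
pose leaf i := val (leaf0 i).
have leaf_inj : injective leaf by move=> i j /val_inj/leaf0_inj.
have leafS i : leaf i \notin S by have:= valP (leaf0 i); rewrite !inE => /andP[].
have leafN i : exists2 s, s \in S & adj s (leaf i).
  by have:= valP (leaf0 i); rewrite !inE => /andP[_ /exists_inP].
(* Each leaf, and the centre as well, gets its own copy of [G]; this takes [k + 1] vertices of
   [H]. *)
have [|h h_inj] := @leq_card_injection (option 'I_k) H; first by rewrite card_option card_ord.
have sizeI : #|{: option 'I_k}| = k.+1 by rewrite card_option card_ord.
rewrite -sizeI.
pose C (o : option 'I_k) : {set P} :=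
  setX S [set h o] :|: (if o is Some i then setX [set leaf i] [set: H] else set0).
have adjC i o : Some i != o -> exists x y, [/\ x \in C (Some i), y \in C o & adj x y].
  move=> io; have [s Ss sl] := leafN i; exists (leaf i, h o), (s, h o).
  by rewrite !inE Ss /= /cartesian_adj /= adj_sym sl !eqxx orbT.
have /andP[/set0Pn[s0 Ss0] _] := conS.
apply: (@hadwiger_ge _ _ C); split.
- case=> [i|]; last by rewrite /C setU0; apply: connected_row.
  have [s Ss sl] := leafN i.
  apply: (@connected_setU P _ _ (s, h (Some i)) (leaf i, h (Some i))).
  + exact: connected_row.
  + exact: connected_col.
  + by rewrite !inE Ss /=.
  + by rewrite !inE /= eqxx.
  + by rewrite /= /cartesian_adj /= sl eqxx.
- move=> o o' [x y]; rewrite !inE /=.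
  (* A point over [S] determines the index by its second coordinate, and a point over a leaf by its
     first. The two kinds never coincide, as leaves lie outside [S]. *)
  have CE o1 : (x, y) \in C o1 -> (x \in S) /\ y = h o1 \/ exists2 i, o1 = Some i & x = leaf i.
    case: o1 => [i|]; rewrite !inE /=; last by rewrite orbF => /andP[? /eqP]; left.
    by case/orP=> [/andP[? /eqP]|]; [left | rewrite andbT => /eqP; right; exists i].
  move=> /orP inC /orP inC'.
  have{inC}: (x, y) \in C o by rewrite !inE /=; apply/orP.
  have{inC'}: (x, y) \in C o' by rewrite !inE /=; apply/orP.
  move=> /CE[[Sx yh]|[i -> xi]] /CE[[Sx' yh']|[j -> xj]].
  + by apply: h_inj; rewrite -yh -yh'.
  + by have:= leafS j; rewrite -xj Sx.
  + by have:= leafS i; rewrite -xi Sx'.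
  + by congr Some; apply: leaf_inj; rewrite -xi -xj.
case=> [i|] o io; first exact: adjC.
case: o io => // j _; have [//|x [y [Cx Cy xy]]] := @adjC j None.
by exists y, x; rewrite adj_sym.
Qed.

End ProductModels.

(** * Colorings of the product *)

Lemma colorable_leq (G : sgraph) k m : k <= m -> colorable G k -> colorable G m.
Proof.
move=> lekm /existsP[f /forallP colf]; apply/existsP.
exists [ffun x => widen_ord lekm (f x)]; apply/forallP=> x; apply/forallP=> y.
apply/implyP=> xy; have /forallP/(_ y)/implyP/(_ xy) := colf x.
by rewrite !ffunE; apply: contra_neq => /(congr1 val)/= /val_inj.
Qed.

Lemma colorable_product (G H : sgraph) k :
  colorable G k -> colorable H k -> colorable (cartesian_product G H) k.
Proof.
(* Reduction modulo [k] needs [k > 0]; with no colors, [G] and the product are empty. *)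
case: k => [|k] /existsP[f colf] /existsP[g colg].
  by apply/existsP; exists [ffun p => f p.1]; apply/forallP=> -[x]; case: (f x).
have {colf} f_adj x y : adj x y -> f x != f y.
  by move=> xy; move/forallP/(_ x)/forallP/(_ y)/implyP: colf; apply.
have {colg} g_adj x y : adj x y -> g x != g y.
  by move=> xy; move/forallP/(_ x)/forallP/(_ y)/implyP: colg; apply.
apply/existsP; exists [ffun p => inord ((f p.1 + g p.2) %% k.+1)].
apply/forallP=> -[x y]; apply/forallP=> -[x' y']; rewrite /= /cartesian_adj /=.
apply/implyP; rewrite !ffunE -val_eqE /= !inordK ?ltn_pmod //.
case/orP=> /andP[].
  move=> /f_adj + /eqP<-; apply: contraNN.
  by rewrite eqn_modDr !modn_small // val_eqE.
move=> /eqP<- /g_adj; apply: contraNN.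
by rewrite eqn_modDl !modn_small // val_eqE.
Qed.

(** * Partial colorings and criticality *)

Section Coloring.
Variable G : sgraph.
Implicit Types (A : {set G}) (u v x y : G) (r : nat).

Lemma colorable_nat r (f : G -> nat) : (forall x, f x < r) ->
  (forall x y, adj x y -> f x != f y) -> colorable G r.
Proof.
move=> ltf colf; apply/existsP; exists [ffun x => Ordinal (ltf x)].
apply/forallP=> x; apply/forallP=> y; apply/implyP=> /colf.
by rewrite !ffunE -val_eqE.
Qed.

Lemma colorable_image r (T : finType) (f : G -> T) :
  #|[set f x | x in G]| <= r -> (forall x y, adj x y -> f x != f y) -> colorable G r.
Proof.
move=> le_r colf.
have enumf x : f x \in enum [set f x | x in G] by rewrite mem_enum imset_f.
apply: (@colorable_nat r (fun x => index (f x) (enum [set f x | x in G]))) => [x|x y xy].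
  by apply: leq_trans le_r; rewrite cardE index_mem.
by apply: contraNneq (colf x y xy) => /(congr1 (nth (f x) (enum [set f z | z in G]))); rewrite !nth_index // => ->.
Qed.

(** The spare color [r] is a default value outside [A]; thus the empty set is colorable even for
    [r = 0]. *)
Definition colorable_on r A := [exists f : {ffun G -> 'I_r.+1}, [forall x in A,
  (f x < r) && [forall y in A, adj x y ==> (f x != f y)]]].

Lemma colorable_onP r A : reflect
  (exists f : G -> nat, (forall x, x \in A -> f x < r) /\
     (forall x y, x \in A -> y \in A -> adj x y -> f x != f y))
  (colorable_on r A).
Proof.
apply: (iffP existsP) => [[f /forall_inP colf]|[f [ltf colf]]].
  exists (fun x => nat_of_ord (f x)); split=> [x /colf/andP[]//|x y Ax Ay xy].
  by have /andP[_ /forall_inP/(_ y Ay)/implyP/(_ xy)] := colf x Ax.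
exists [ffun x => inord (f x)]; apply/forall_inP=> x Ax.
have lt_f z : z \in A -> f z < r.+1 by move/ltf/ltnW.
rewrite !ffunE inordK ?lt_f // ltf //=; apply/forall_inP=> y Ay; apply/implyP=> xy.
by rewrite ffunE -val_eqE /= !inordK ?lt_f // colf.
Qed.

Lemma colorable_onT r : colorable_on r setT -> colorable G r.
Proof.
case/colorable_onP=> f [ltf colf].
by apply: (@colorable_nat _ f) => [x|x y]; [apply: ltf | apply: colf]; rewrite ?inE.
Qed.

Definition nbh v := [set x | adj v x].

(** Greedy step: the neighbors of [v] in [A] leave one of the [r] colors free. *)
Lemma colorable_on_extend r A v :
  colorable_on r (A :\ v) -> #|nbh v :&: A| < r -> colorable_on r A.
Proof.
case/colorable_onP=> f [ltf colf] lt_r.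
pose s := [seq f x | x <- enum (nbh v :&: A)].
have [c c_r c_s] : exists2 c, c < r & c \notin s.
  have [/allP sub|/allPn[c]] := boolP (all [in s] (iota 0 r)); last first.
    by rewrite mem_iota; exists c.
  have:= uniq_leq_size (iota_uniq 0 r) sub.
  by rewrite size_iota size_map -cardE leqNgt lt_r.
have c_nbh x : x \in A -> adj v x -> f x != c.
  move=> Ax vx; apply: contraNneq c_s => <-; apply: map_f.
  by rewrite mem_enum !inE vx.
apply/colorable_onP; exists (fun x => if x == v then c else f x); split=> [x Ax|x y Ax Ay xy].
  by case: eqP => // /eqP xv; rewrite ltf // !inE xv.
case: (eqVneq x v) (eqVneq y v) => [xv|xv] [yv|yv].
- by move: xy; rewrite xv yv adj_irrefl.
- by rewrite eq_sym c_nbh // -xv.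
- by rewrite c_nbh // adj_sym -yv.
- by rewrite colf // !inE ?xv ?yv.
Qed.

(* A minimal non-[r]-colorable vertex set has minimum degree at least [r]; here it is therefore
   closed under adjacency, and is everything. *)
Lemma critical_regular r : connected_graph G -> ~~ colorable G r ->
  (forall v, #|nbh v| <= r) ->
  (forall v, #|nbh v| = r) /\ (forall v, colorable_on r (setT :\ v)).
Proof.
move=> conG ncol deg_le.
have [|A /minsetP[/= ncolA minA]] := @ex_minset _ (fun A => ~~ colorable_on r A).
  by exists setT; apply: contra ncol => /colorable_onT.
have colA v : v \in A -> colorable_on r (A :\ v).
  move=> Av; apply: contraLR Av => /minA/(_ (subsetDl _ _)) <-.
  by rewrite !inE eqxx.
have degA v : v \in A -> r <= #|nbh v :&: A|.
  move=> Av; rewrite leqNgt; apply: contra ncolA.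
  exact: colorable_on_extend (colA v Av).
have closedA u v : u \in A -> adj u v -> v \in A.
  move=> Au uv; have : nbh u :&: A == nbh u.
    by rewrite eqEcard subsetIl (leq_trans (deg_le u)) ?degA.
  by move/eqP/setIidPl/subsetP; apply; rewrite inE.
have [x Ax] : exists x, x \in A.
  apply/set0Pn; apply: contraNneq ncolA => ->; apply/colorable_onP.
  by exists (fun=> 0); split=> x; rewrite ?inE // => y; rewrite inE.
have AT : A = setT.
  by apply/setP=> y; rewrite inE; apply: connected_graph_closed Ax y.
split=> v; last by rewrite -AT colA // AT inE.
by apply/eqP; rewrite eqn_leq deg_le (leq_trans (degA v _)) ?AT ?inE // subset_leq_card ?subsetIl.
Qed.

(** Neighborhoods are cliques, so the closed neighborhood of [x] is closed under adjacency and is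
    the whole graph. *)
Lemma complete_of_transitive : connected_graph G ->
  (forall v a c, adj v a -> adj v c -> a != c -> adj a c) ->
  forall x y, x != y -> adj x y.
Proof.
move=> conG trG x y xy.
have: (y == x) || adj x y; last by rewrite eq_sym (negPf xy).
apply: (@connected_graph_closed _ (fun y => (y == x) || adj x y) x conG); last by rewrite eqxx.
move=> u v /= /orP[/eqP->->|xu uv]; first by rewrite orbT.
have [->|vx] /= := eqVneq v x; first by [].
by rewrite (trG u) ?orbT // 1?adj_sym // eq_sym.
Qed.

(** * Regular graphs whose edges have few outside neighbors *)

Section SmallEdgeBoundary.
Variable r : nat.
Hypothesis regG : forall v, #|nbh v| = r.
Hypothesis edge_le : forall x y, adj x y -> #|neighbors [set x; y]| <= r.

(** If [p] and [q] differed, they and the [r - 1] neighbors of [y] other than [x] would be [r + 1]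
    outside neighbors of the edge [x y]. *)
Lemma private_neighbor_unique x y p q : adj x y -> adj x p -> adj x q ->
  ~~ adj y p -> ~~ adj y q -> p != y -> q != y -> p = q.
Proof.
move=> xy xp xq yp yq py qy; apply/eqP; apply: contraT => pq.
have neq_adj u w : adj u w -> w != u by apply: contraTneq => ->; rewrite adj_irrefl.
have sub : [set p; q] :|: (nbh y :\ x) \subset neighbors [set x; y].
  apply/subsetP=> z zin; rewrite !inE negb_or.
  have [[zx zy] [s sxy sz]] :
      (z != x /\ z != y) /\ exists2 s, s \in [set x; y] & adj s z.
    move: zin; rewrite !inE => /orP[/orP[]/eqP->|/andP[zx yz]].
    - by split; [rewrite neq_adj ?py ?qy ?zx | exists x; rewrite // set21].
    - by split; [rewrite neq_adj ?py ?qy ?zx | exists x; rewrite // set21].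
    - by split; [rewrite zx neq_adj | exists y; rewrite // set22].
  by rewrite zx zy; apply/exists_inP; exists s.
have:= leq_trans (subset_leq_card sub) (edge_le xy).
rewrite cardsU cards2 pq.
have -> : [set p; q] :&: (nbh y :\ x) = set0.
  apply/setP=> z; rewrite !inE; apply/negP=> /and3P[/orP[]/eqP-> _].
    by apply/negP.
  by apply/negP.
have:= regG y; rewrite (cardsD1 x) inE adj_sym xy cards0 subn0 => <-.
by rewrite ltnn.
Qed.

(* [G] is then the complete multipartite graph [K_{2,...,2}] on [r + 2] vertices; identifying two of
   its nonadjacent pairs gives the coloring. *)
Lemma noncomplete_colorable v a c : connected_graph G -> 2 < r ->
  adj v a -> adj v c -> a != c -> ~~ adj a c -> colorable G r.
Proof.
move=> conG r_gt2 va vc ac nac.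
have neq_adj u w : adj u w -> w != u by apply: contraTneq => ->; rewrite adj_irrefl.
have nca : ~~ adj c a by rewrite adj_sym.
have ca : c != a by rewrite eq_sym.
(* Otherwise the [r - 1] neighbors of [a] other than [v] would all be among the [r - 2] neighbors of
   [v] other than [a] and [c]. *)
have [a' /and3P[aa' a'v nva']] : exists a', [&& adj a a', a' != v & ~~ adj v a'].
  apply/existsP; apply: contraT => /existsPn none.
  have sub : nbh a :\ v \subset (nbh v :\ a) :\ c.
    apply/subsetP=> z; rewrite !inE => /andP[zv az].
    have:= none z; rewrite az zv /= negbK => ->; rewrite (neq_adj _ _ az) !andbT.
    by apply: contraTneq az => ->.
  have:= subset_leq_card sub.
  have := regG a; rewrite (cardsD1 v) inE adj_sym va add1n => ra.
  have := regG v; rewrite (cardsD1 a) inE va (cardsD1 c) !inE ca vc !add1n => rv.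
  by move: ra; rewrite -rv => -[->]; rewrite ltnn.
have adj_a b : adj v b -> b != a -> b != c -> adj a b.
  move=> vb ba bc; apply: contraT => nab; case/eqP: bc.
  by apply: (@private_neighbor_unique v a).
have adj_c b : adj v b -> b != a -> b != c -> adj c b.
  move=> vb ba bc; apply: contraT => ncb; case/eqP: ba.
  by apply: (@private_neighbor_unique v c).
have nva : v != a' by rewrite eq_sym.
have na'v : ~~ adj a' v by rewrite adj_sym.
have neq_a' b : adj v b -> b != a' by move=> vb; apply: contraNneq nva' => <-.
(* Otherwise [b] and [v] would be two neighbors of [a] that are not adjacent to [a']. *)
have adj_a' b : adj v b -> b != c -> adj a' b.
  move=> vb bc; have [->|ba] := eqVneq b a; first by rewrite adj_sym.
  apply: contraT => na'b; case/eqP: (neq_adj _ _ vb).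
  apply: (@private_neighbor_unique a a') => //; first exact: adj_a.
  - by rewrite adj_sym.
  - exact: neq_a'.
(* A third neighbor of [v] exists because [r > 2]; it is adjacent to [c], [v] and [a'], which allows
   the same argument on the edge [b a']. *)
have [b vb /andP[ba bc]] : exists2 b, adj v b & (b != a) && (b != c).
  have: 0 < #|nbh v :\: [set a; c]|.
    rewrite cardsD regG subn_gt0; apply: leq_ltn_trans r_gt2.
    by rewrite (leq_trans (subset_leq_card (subsetIr _ _))) // cards2 ac.
  by case/card_gt0P=> b; rewrite !inE negb_or => /andP[? ?]; exists b.
have a'c : adj a' c.
  apply: contraT => na'c; case/eqP: (neq_adj _ _ vc).
  apply: (@private_neighbor_unique b a') => //.
  - by rewrite adj_sym adj_a'.
  - by rewrite adj_sym adj_c.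
  - by rewrite adj_sym.
  - exact: neq_a'.
have adj_va' x : adj v x -> adj a' x.
  by move=> vx; have [->|xc] := eqVneq x c; [|apply: adj_a'].
have nbh_a' : nbh v = nbh a'.
  apply/eqP; rewrite eqEcard !regG leqnn andbT.
  by apply/subsetP=> x; rewrite !inE; apply: adj_va'.
(* A neighbor [w] of some [u] in [nbh v], with [w] neither [v] nor adjacent to it, equals [a']: both
   are neighbors of [u] not adjacent to [v]. *)
have spanned x : x \in v |: (a' |: nbh v).
  apply: (@connected_graph_closed _ (fun x => x \in v |: (a' |: nbh v)) v) => //; last first.
    by rewrite !inE eqxx.
  move=> u w; rewrite !inE => /or3P[/eqP->->|/eqP-> a'w|vu uw]; rewrite ?orbT //.
    by move/setP/(_ w): nbh_a'; rewrite !inE a'w => ->; rewrite !orbT.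
  have [_|wv] /= := eqVneq w v; first by [].
  have [vw|nvw] := boolP (adj v w); first by rewrite orbT.
  rewrite orbF; apply/eqP; apply: (@private_neighbor_unique u v) => //.
    by rewrite adj_sym.
  by rewrite adj_sym adj_va'.
(* The nonadjacent pairs [v], [a'] and [a], [c] are merged; the values left are [v] and its
   neighbors other than [c], at most [r] in all. *)
pose f x := if x == a' then v else if x == c then a else x.
have fE x : [|| f x == x, x == a' | x == c].
  by rewrite /f; case: (x == a'); case: (x == c); rewrite ?orbT ?eqxx.
apply: (@colorable_image _ _ f).
  have sub : [set f x | x in G] \subset v |: (nbh v :\ c).
    apply/subsetP=> _ /imsetP[x _ ->]; rewrite /f !inE.
    have [_|xa'] := eqVneq x a'; first by rewrite eqxx.
    have [_|xc] := eqVneq x c; first by rewrite ac va orbT.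
    by have:= spanned x; rewrite !inE (negPf xa') (negPf xc).
  apply: leq_trans (subset_leq_card sub) _.
  rewrite cardsU1 !inE adj_irrefl andbF /=.
  by have:= regG v; rewrite (cardsD1 c) inE vc => <-.
move=> x y xy; rewrite /f; apply: contraTneq xy.
have [->|xa'] := eqVneq x a'; have [->|ya'] := eqVneq y a'; rewrite ?adj_irrefl //.
- have [_ e|_ <-] := eqVneq y c; last by [].
  by move: va; rewrite e adj_irrefl.
- have [_ e|_ ->] := eqVneq x c; last by rewrite adj_sym.
  by move: va; rewrite e adj_irrefl.
have [->|xc] := eqVneq x c; have [->|yc] := eqVneq y c; rewrite ?adj_irrefl //.
- by move=> <-.
- by move=> ->.
by move=> ->; rewrite adj_irrefl.
Qed.

End SmallEdgeBoundary.

(** * The 2-regular case *)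

(* If [a] had no neighbor in the component [D] of [c] in [G - {v, a}], swapping the two colors on [D]
   would free a color for [v]. *)
Lemma cycle_clique_model v a c : (forall v, #|nbh v| = 2) -> ~~ colorable G 2 ->
  colorable_on 2 (setT :\ v) -> adj v a -> adj v c -> a != c ->
  exists B : option bool -> {set G}, clique_model B.
Proof.
move=> regG ncol colv va vc ac.
have neq_adj u w : adj u w -> w != u by apply: contraTneq => ->; rewrite adj_irrefl.
have nbh_v x : adj v x -> x = a \/ x = c.
  have : nbh v == [set a; c].
    by rewrite eq_sym eqEcard regG cards2 ac subUset !sub1set !inE va vc.
  by move/eqP/setP/(_ x); rewrite !inE => -> /orP[]/eqP; [left | right].
pose A := ~: [set v; a].
have Ac : c \in A by rewrite !inE negb_or neq_adj // eq_sym.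
pose D := [set x | connect (adj_in A) c x].
have Dc : c \in D by rewrite inE connect0.
have DA x : x \in D -> x \in A.
  rewrite inE; apply: (@connect_closed _ _ [in A]) => // u w _ /and3P[//].
have nDv : v \notin D by apply/negP=> /DA; rewrite !inE eqxx.
have nDa : a \notin D by apply/negP=> /DA; rewrite !inE eqxx orbT.
have closedD x y : x \in D -> y \in A -> adj x y -> y \in D.
  move=> Dx Ay xy; have Ax := DA x Dx; move: Dx; rewrite !inE => /connect_trans; apply.
  by apply: connect1; rewrite /adj_in Ax Ay.
have [d Dd ad] : exists2 d, d \in D & adj a d.
  apply/exists_inP; apply: contraR ncol => /exists_inPn noD.
  have [f [ltf colf]] := colorable_onP _ _ colv.
  have lt2 x : x != v -> f x < 2 by move=> xv; rewrite ltf // !inE xv.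
  have f2 x : x != v -> f x = (f x == 1).
    by move/lt2; case: (f x) => [|[]].
  have{colf} colf x y : x != v -> y != v -> adj x y -> (f x == 1) != (f y == 1).
    move=> xv yv xy; have:= colf x y; rewrite !inE xv yv => /(_ isT isT xy).
    by rewrite f2 // (f2 y) //; case: (f x == 1); case: (f y == 1).
  (* The swap is made only if [a] and [c] have different colors. Afterwards they agree, and [v]
     takes the opposite color. *)
  pose s := (f a == 1) != (f c == 1).
  pose g x := if x == v then ~~ (f a == 1) else (f x == 1) (+) (s && (x \in D)).
  have gv y : adj v y -> g v != g y.
    move=> vy; rewrite /g eqxx (negPf (neq_adj _ _ vy)).
    case: (nbh_v y vy) => ->; rewrite ?(negPf nDa) ?Dc /s.
      by case: (f a == 1); rewrite andbF.
    by case: (f a == 1); case: (f c == 1).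
  apply: (@colorable_nat _ (fun x => nat_of_bool (g x))) => [x|x y xy]; first by case: (g x).
  suff: g x != g y by case: (g x); case: (g y).
  have [xv|xv] := eqVneq x v; first by rewrite xv gv // -xv.
  have [yv|yv] := eqVneq y v; first by rewrite yv eq_sym gv // -yv adj_sym.
  (* An edge avoiding [v] could leave [D] only towards [a], which [noD] excludes. *)
  have sameD u w : w != v -> adj u w -> u \in D -> w \in D.
    move=> wv uw Du; apply: (closedD u) => //; rewrite !inE (negPf wv) /=.
    by apply: contraNneq (noD u Du) => <-; rewrite adj_sym.
  have -> : g x = (f x == 1) (+) (s && (x \in D)) by rewrite /g (negPf xv).
  have -> : g y = (f y == 1) (+) (s && (x \in D)).
    rewrite /g (negPf yv); congr (_ (+) (_ && _)); apply/idP/idP; apply: sameD => //.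
    by rewrite adj_sym.
  by rewrite (inj_eq (@addIb _)) colf.
pose B (o : option bool) := if o is Some b then if b then [set a] else D else [set v].
exists B; split.
- case=> [[]|] /=; try exact: connected_set1; exact: connected_component.
- move=> o o' z; move: o o' => [[]|] [[]|] //=; rewrite /B ?[z \in [set _]]in_set1.
  + by move/eqP->; rewrite (negPf nDa).
  + by move/eqP->; rewrite (negPf (neq_adj _ _ va)).
  + by move=> + /eqP=> /[swap] ->; rewrite (negPf nDa).
  + by move=> + /eqP=> /[swap] ->; rewrite (negPf nDv).
  + by move/eqP->; rewrite eq_sym (negPf (neq_adj _ _ va)).
  + by move/eqP->; rewrite (negPf nDv).
case=> [[]|] [[]|] // _.
- by exists a, d; rewrite set11.
- by exists a, v; rewrite !set11 adj_sym.
- by exists d, a; rewrite set11 adj_sym.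
- by exists c, v; rewrite set11 adj_sym.
- by exists v, a; rewrite !set11.
- by exists v, c; rewrite set11.
Qed.

End Coloring.

(** * The minor in the product and the final bound *)

Lemma chromatic_numberP (G : sgraph) :
  colorable G (chromatic_number G) /\ forall m, colorable G m -> chromatic_number G <= m.
Proof. by rewrite /chromatic_number; case: ex_minnP. Qed.

Lemma hadwiger_product (G H : sgraph) r : connected_graph G -> connected_graph H ->
  ~~ colorable G r -> r.+1 < #|H| -> r.+2 <= hadwiger (cartesian_product G H).
Proof.
move=> conG conH ncol r_ltH.
have H_gt1 : 1 < #|H| by apply: leq_trans r_ltH.
have model (I : finType) (B : I -> {set G}) : r < #|I| -> clique_model B ->
    r.+2 <= hadwiger (cartesian_product G H).
  by move=> r_ltI /(hadwiger_prod_edge conG conH)/(_ H_gt1); apply: leq_trans.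
have star (S : {set G}) : connected_set S -> r < #|neighbors S| ->
    r.+2 <= hadwiger (cartesian_product G H).
  by move=> conS r_lt; apply: (hadwiger_prod_star conH conS).
have [/existsP[v r_ltv]|/existsPn/= deg_le] := boolP [exists v : G, r < #|nbh v|].
  apply: (star [set v]); first exact: connected_set1.
  apply: leq_trans r_ltv _; apply/subset_leq_card/subsetP=> x; rewrite !inE => vx.
  apply/andP; split; first by apply: contraTneq vx => ->; rewrite adj_irrefl.
  by apply/exists_inP; exists v; rewrite ?set11.
have [|regG crit] := critical_regular conG ncol.
  by move=> v; rewrite leqNgt.
have [/existsP[u /existsP[v /andP[uv r_lt]]]|/existsPn/= noedge] :=
    boolP [exists u : G, exists v : G, adj u v && (r < #|neighbors [set u; v]|)].
  apply: star r_lt; apply: (connected_setU (connected_set1 u) (connected_set1 v) _ _ uv);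
  by rewrite set11.
have edge_le (x y : G) : adj x y -> #|neighbors [set x; y]| <= r.
  by move=> xy; have /existsPn/(_ y) := noedge x; rewrite xy -leqNgt.
have [/existsP[v /existsP[a /existsP[c /and4P[va vc ac nac]]]]|/existsPn/= noncl] :=
    boolP [exists v : G, exists a : G, exists c : G,
             [&& adj v a, adj v c, a != c & ~~ adj a c]].
  (* The distinct neighbors [a] and [c] of [v] give [r >= 2], so only [r = 2] escapes
     [noncomplete_colorable]. *)
  have r_gt1 : 1 < r.
    rewrite -(regG v) -(_ : #|[set a; c]| = 2); last by rewrite cards2 ac.
    by apply: subset_leq_card; rewrite subUset !sub1set !inE va vc.
  have [r_gt2|r_le2] := ltnP 2 r.
    by case/negP: ncol; apply: (noncomplete_colorable regG edge_le conG r_gt2 va vc ac nac).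
  have r2 : r = 2 by apply/eqP; rewrite eqn_leq r_le2.
  subst r; have [B modB] := cycle_clique_model regG ncol (crit v) va vc ac.
  by apply: model modB; rewrite card_option card_bool.
have complete : forall x y : G, x != y -> adj x y.
  apply: complete_of_transitive => // v a c va vc ac.
  have /existsPn/(_ a)/existsPn/(_ c) := noncl v.
  by rewrite va vc ac /= negbK.
(* In a complete graph the singletons form a model. There are more than [r] of them, as the identity
   would otherwise be an [r]-coloring. *)
apply: (model G (fun x => [set x])).
  rewrite ltnNge; apply: contra ncol => G_le; apply: (@colorable_image _ _ _ id).
    exact: leq_trans (max_card _) G_le.
  by move=> x y; apply: contraTneq => ->; rewrite adj_irrefl.
split=> [x|x y z|x y xy]; first exact: connected_set1.
  by rewrite !inE => /eqP<- /eqP.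
by exists x, y; rewrite !set11 complete.
Qed.

Theorem mainTheorem2 (G H : sgraph)
  (connG : connected_graph G) (connH : connected_graph H)
  (chiG_le : chromatic_number G <= #|H| - 1)
  (chiH_le : chromatic_number H <= chromatic_number G) :
  chromatic_number (cartesian_product G H)
    <= hadwiger (cartesian_product G H) - 1.
Proof.
have [[colG minG] [colH _]] := (chromatic_numberP G, chromatic_numberP H).
have [_ minGH] := chromatic_numberP (cartesian_product G H).
apply: leq_trans (minGH _ (colorable_product colG (colorable_leq chiH_le colH))) _.
(* For chromatic number 0 the left-hand side is 0. Otherwise [G] is not [r]-colorable, by minimality
   of [r + 1]. *)
case def_k: (chromatic_number G) => [|r] //.
suff: r.+2 <= hadwiger (cartesian_product G H) by move/(leq_sub2r 1); rewrite subn1.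
apply: hadwiger_product => //.
  by apply/negP=> /minG; rewrite def_k ltnn.
(* Truncated subtraction is harmless: an empty [H] would give [r + 1 <= 0]. *)
by move: chiG_le; rewrite def_k subn1; case: #|H|.
Qed.
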